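(* Let $r>0$ and $\mu>0$. Let $f:\mathbb{R}^n\to\mathbb{R}$ be a differentiable $\mu$-strongly convex function with minimum value $f_*$. Let $x:(0,\infty)\to\mathbb{R}^n$ be a twice differentiable solution of $$\ddot{x}(t)+\frac{r}{t}\dot{x}(t)+\nabla f(x(t))=0,\qquad t>0.$$ Put $T=\sqrt{\frac{2r^2}{9\mu}}$. Then $$f(x(t))-f_*=\mathrm{O}\left(t^{-\frac{2}{3}r}\right)\qquad\text{for } t\ge T.$$
   Context: $\|\cdot\|$ and $\langle\cdot,\cdot\rangle$ are the Euclidean norm and inner product on $\mathbb{R}^n$. For $\mu>0$, a differentiable function $f:\mathbb{R}^n\to\mathbb{R}$ is $\mu$-strongly convex if $f(y)\ge f(x)+\langle\nabla f(x),y-x\rangle+\frac{\mu}{2}\|y-x\|^2$ for all $x,y\in\mathbb{R}^n$. The notation $\phi(t)=\mathrm{O}(\psi(t))$ for $t\ge T$ (with $\psi>0$) means that there is a constant $C$, independent of $t$ (but possibly depending on $f$, $r$ and the solution $x$), such that $|\phi(t)|\le C\psi(t)$ for all $t\ge T$. *)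

(* Defs.v *)
From HB Require Import structures.
From mathcomp Require Import all_boot all_order all_algebra.
From mathcomp Require Import all_classical all_reals all_analysis.
Set Implicit Arguments.
Unset Strict Implicit.
Unset Printing Implicit Defensive.
Import Order.TTheory GRing.Theory Num.Theory.
Import numFieldNormedType.Exports.
Local Open Scope classical_set_scope.
Local Open Scope ring_scope.

Definition dot (R : realType) (n : nat) (u v : 'rV[R]_n) : R :=
  \sum_(i < n) u 0 i * v 0 i.

(* The library norm `|v| on 'rV[R]_n is the sup norm, hence a separate
   Euclidean norm.  The two are equivalent, so [differentiable] and
   [derivable] on 'rV[R]_n are the usual notions. *)
Definition enorm (R : realType) (n : nat) (v : 'rV[R]_n) : R :=
  Num.sqrt (dot v v).

Definition grad (R : realType) (n : nat) (f : 'rV[R]_n -> R) (p : 'rV[R]_n) :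
    'rV[R]_n :=
  \row_(i < n) 'D_(delta_mx 0 i : 'rV[R]_n) f p.

(* Meaningful for differentiable f only: 'D_v f is a junk value elsewhere. *)
Definition strongly_convex (R : realType) (n : nat) (mu : R)
    (f : 'rV[R]_n -> R) : Prop :=
  forall p q : 'rV[R]_n,
    f p + dot (grad f p) (q - p) + mu / 2 * enorm (q - p) ^+ 2 <= f q.

Definition is_min_value (R : realType) (n : nat) (f : 'rV[R]_n -> R) (m : R) :
    Prop :=
  (exists p, f p = m) /\ (forall q, m <= f q).

(* x is total on R, but derivatives at t > 0 only see x on (0, +oo). *)
Definition twice_derivable_pos (R : realType) (n : nat) (x : R -> 'rV[R]_n) :
    Prop :=
  forall t : R, 0 < t -> derivable x t 1 /\ derivable (derive1 x) t 1.

(* An estimate on the whole half-line [T, +oo), not merely as t --> +oo. *)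
Definition bigO_from (R : realType) (T : R) (phi psi : R -> R) : Prop :=
  exists C : R, forall t : R, T <= t -> `|phi t| <= C * psi t.

(* Main.v *)
Require Import Defs.
From HB Require Import structures.
From mathcomp Require Import all_boot all_order all_algebra.
From mathcomp Require Import all_classical all_reals all_analysis.
From mathcomp Require Import ring lra.
Import Order.TTheory GRing.Theory Num.Theory.
Import numFieldNormedType.Exports.
Local Open Scope classical_set_scope.
Local Open Scope ring_scope.

(** The proof is a Lyapunov argument.  Let [c] be a minimizer of [f], and write
    [W = f x - f c], [u = x - c], [v = x'] and [k = 2 r / 3].  The quantity

      [H = t^(k-2) (t^2 W + |k u + t v|^2 / 2 + k (1 - r/3) |u|^2 / 2)]

    has its coefficients tuned so that, along the equation, the terms of [H']
    in [|v|^2] and [<u, v>] cancel and those in [W] and [<grad f x, u>] have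
    opposite weights:

      [H' = k t^(k-3) (t^2 (W - <grad f x, u>) + (r^2/9 - 1) |u|^2)].

    Strong convexity gives [W - <grad f x, u> <= - mu |u|^2 / 2], so [H' <= 0]
    as soon as [mu t^2 / 2 >= r^2 / 9], which is what [t >= T] says
    ([is_derive_lyapunov], [lyapunov_nonincreasing]).

    For [r > 3] the last coefficient of [H] is negative and [H] might fail to
    control [W].  The quadratic growth [W >= mu |u|^2 / 2] repairs this on the
    same range of times: [t^2 W >= r^2 |u|^2 / 9] there, and this leads to
    [t^k W <= (1 + r/3) H] for every [r > 0] ([lyapunov_lower_bound]).
    Hence [t^k W <= (1 + r/3) H(T)] on [[T, +oo)]. *)

(** * Bilinearity of the inner product *)

Section Dot.
Context {R : realType} {n : nat}.
Implicit Types (u v w : 'rV[R]_n) (a : R).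

Lemma dotC u v : dot u v = dot v u.
Proof. by apply: eq_bigr => i _; rewrite mulrC. Qed.

Lemma dotDr u v w : dot u (v + w) = dot u v + dot u w.
Proof. by rewrite -big_split; apply: eq_bigr => i _; rewrite mxE mulrDr. Qed.

Lemma dotDl u v w : dot (u + v) w = dot u w + dot v w.
Proof. by rewrite ![dot _ w]dotC dotDr. Qed.

Lemma dotZr a u v : dot u (a *: v) = a * dot u v.
Proof. by rewrite mulr_sumr; apply: eq_bigr => i _; rewrite mxE mulrCA. Qed.

Lemma dotZl a u v : dot (a *: u) v = a * dot u v.
Proof. by rewrite dotC dotZr dotC. Qed.

Lemma dotNr u v : dot u (- v) = - dot u v.
Proof. by rewrite -scaleN1r dotZr mulN1r. Qed.

Lemma dot_ge0 v : 0 <= dot v v.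
Proof. by apply: sumr_ge0 => i _; exact: sqr_ge0. Qed.

Lemma sqr_enorm v : enorm v ^+ 2 = dot v v.
Proof. by rewrite sqr_sqrtr ?dot_ge0. Qed.

End Dot.

(** * Derivatives along curves *)

Section Calculus.
Context {R : realType} {n : nat}.
Implicit Types (f : 'rV[R]_n -> R) (p q v : 'rV[R]_n) (y z : R -> 'rV[R]_n).

Lemma is_derive_coord y (t : R) (dy : 'rV[R]_n) i :
  is_derive t 1 y dy -> is_derive t 1 (fun s => y s 0 i) (dy 0 i).
Proof.
move=> [y_drv <-]; apply: DeriveDef; first exact: (derivable_mxP _ _ _).1.
by rewrite derive_mx// mxE.
Qed.

Lemma is_derive_dot y z (t : R) (dy dz : 'rV[R]_n) :
  is_derive t 1 y dy -> is_derive t 1 z dz ->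
  is_derive t 1 (fun s => dot (y s) (z s)) (dot dy (z t) + dot (y t) dz).
Proof.
move=> dyt dzt.
have -> : (fun s => dot (y s) (z s)) =
    \sum_(i < n) (fun s => y s 0 i * z s 0 i).
  by apply/funext => s; rewrite fct_sumE.
rewrite /dot -big_split; apply: is_derive_sum => i.
have := is_derive_coord _ _ _ i dyt; have := is_derive_coord _ _ _ i dzt => dzi dyi.
have dyz := is_deriveM dyi dzi.
apply: is_derive_eq dyz _.
by rewrite addrC; congr (_ + _); exact: mulrC.
Qed.

(** [grad] only records partial derivatives; differentiability is what makes it
    represent the full differential. *)
Lemma diff_grad f p v : differentiable f p -> 'd f p v = dot (grad f p) v.
Proof.
move=> f_diff; rewrite {1}(row_sum_delta v) linear_sum.
by apply: eq_bigr => i _; rewrite linearZ /= mxE deriveE// mulrC.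
Qed.

Lemma is_derive_along f y (t : R) (dy : 'rV[R]_n) :
  differentiable f (y t) -> is_derive t 1 y dy ->
  is_derive t 1 (f \o y) (dot (grad f (y t)) dy).
Proof.
move=> f_diff [y_drv y_dy]; have /derivable1_diffP y_diff := y_drv.
have fy_diff := differentiable_comp y_diff f_diff.
apply: DeriveDef; first exact/derivable1_diffP.
have dy1 : 'd y t 1 = dy by rewrite -deriveE.
by rewrite deriveE// diff_comp//= dy1 diff_grad.
Qed.

Lemma is_derive_line p v (t : R) : is_derive t 1 (fun s : R => p + s *: v) v.
Proof.
have scale_v : is_derive t 1 (fun s : R => s *: v) v.
  apply: DeriveDef; first exact/derivable1_diffP.
  by rewrite deriveE// diff_val /= scale1r.
by apply: is_derive_eq (is_deriveD (is_derive_cst p _ _) scale_v) _; rewrite add0r.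
Qed.

(** Fermat's rule, applied to the restriction of [f] to the line through [p]
    directed by [v]. *)
Lemma dot_grad_min f p v :
  (forall q, differentiable f q) -> (forall q, f p <= f q) ->
  dot (grad f p) v = 0.
Proof.
move=> f_diff p_min; pose line (s : R) := p + s *: v.
have line0 : line 0 = p by rewrite /line scale0r addr0.
have f_line (s : R) : is_derive s 1 (f \o line) (dot (grad f (line s)) v).
  exact: is_derive_along (is_derive_line _ _ _).
have [_ <-] : is_derive (0 : R) 1 (f \o line) 0.
  apply: (@derive1_at_min _ _ (-1) 1) => [|s _||s _].
  - lra.
  - by have [] := f_line s.
  - by rewrite in_itv /= ltrN10 ltr01.
  - by rewrite /= line0.
by have [_ ->] := f_line 0; rewrite line0.
Qed.

End Calculus.

(** * Two consequences of strong convexity *)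

Section StronglyConvex.
Context {R : realType} {n : nat} (mu : R) (f : 'rV[R]_n -> R).
Hypothesis f_sc : strongly_convex mu f.
Implicit Types p c : 'rV[R]_n.

(** Strong convexity based at the minimizer, where the linear term vanishes. *)
Lemma quadratic_growth c p :
  (forall q, differentiable f q) -> (forall q, f c <= f q) ->
  mu / 2 * dot (p - c) (p - c) <= f p - f c.
Proof.
move=> f_diff c_min; have := f_sc c p.
by rewrite dot_grad_min// sqr_enorm; lra.
Qed.

(** Strong convexity based at [p] and tested at [c]: it bounds from below the
    rate at which the force [- grad f] pulls [p] towards [c]. *)
Lemma grad_pull p c :
  f p - f c + mu / 2 * dot (p - c) (p - c) <= dot (grad f p) (p - c).
Proof.
have := f_sc p c; rewrite sqr_enorm -(opprB p c).
by rewrite !dotNr (dotC (- _)) dotNr opprK; lra.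
Qed.

End StronglyConvex.

(** * The Lyapunov function *)

(** With [k = 2 r / 3], the factor [k] inside the square is the one for which
    the [|v|^2] terms of the derivative cancel against the weight [t^(k-2)],
    the exponent [k - 2] is the one that gives the function values and
    the gradient term the same weight [k t^2] up to sign, and the coefficient
    [k (1 - r / 3)] is the one that cancels the cross term [<u, v>]. *)
Definition lyapunov {R : realType} {n : nat} (r : R) (f : 'rV[R]_n -> R)
    (c : 'rV[R]_n) (x : R -> 'rV[R]_n) (t : R) : R :=
  let u := x t - c in
  let w := (2 / 3 * r) *: u + t *: derive1 x t in
  t `^ (2 / 3 * r - 2) *
    (t ^+ 2 * (f (x t) - f c) + dot w w / 2
     + 2 / 3 * r * (1 - r / 3) / 2 * dot u u).

Section Lyapunov.
Context {R : realType} {n : nat} (r mu : R) (f : 'rV[R]_n -> R).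
Context (c : 'rV[R]_n) (x : R -> 'rV[R]_n).
Hypothesis f_diff : forall p, differentiable f p.
Hypothesis x_diff : twice_derivable_pos x.
Hypothesis x_ode : forall t : R, 0 < t ->
  derive1 (derive1 x) t + (r / t) *: derive1 x t + grad f (x t) = 0.

(** The acceleration is replaced by [- (r / t) v - grad f x]; the gradient's
    work [<grad f x, v>] on the velocity then compensates the derivative of
    [f x], and only the pull [<grad f x, u>] towards [c] remains. *)
Lemma is_derive_lyapunov (t : R) : 0 < t ->
  is_derive t 1 (lyapunov r f c x)
    (2 / 3 * r * t `^ (2 / 3 * r - 3) *
      (t ^+ 2 * (f (x t) - f c - dot (grad f (x t)) (x t - c))
       + (r ^+ 2 / 9 - 1) * dot (x t - c) (x t - c))).
Proof.
move=> t_gt0; have [x_drv v_drv] := x_diff t t_gt0.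
pose u s := x s - c; pose v := derive1 x; pose g := grad f (x t).
pose a := - ((r / t) *: v t + g).
have x' : is_derive t 1 x (v t) by apply: DeriveDef x_drv _; rewrite -derive1E.
have u' : is_derive t 1 u (v t).
  by apply: is_derive_eq (is_deriveB x' (is_derive_cst c _ _)) _; rewrite subr0.
have v' : is_derive t 1 v a.
  apply: DeriveDef v_drv _; rewrite -derive1E; apply/eqP.
  by rewrite -addr_eq0 addrA x_ode.
have W' := is_derive_along _ _ _ _ (f_diff (x t)) x'.
have A' := is_derive_dot _ _ _ _ _ u' u'.
have B' := is_derive_dot _ _ _ _ _ u' v'.
have V' := is_derive_dot _ _ _ _ _ v' v'.
pose k := 2 / 3 * r.
(* The square is expanded, so that only scalar products need differentiating. *)
pose E s := s ^+ 2 * (f (x s) - f c)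
  + 2^-1 * (k ^+ 2 * dot (u s) (u s) + 2 * k * (s * dot (u s) (v s))
            + s ^+ 2 * dot (v s) (v s))
  + k * (1 - r / 3) / 2 * dot (u s) (u s).
have -> : lyapunov r f c x = (fun s => s `^ (k - 2) * E s).
  apply/funext => s; rewrite /lyapunov /E -/k -/(u s) -/(v s).
  move: (u s) (v s) => us vs.
  by rewrite !dotDl !dotDr !dotZl !dotZr (dotC vs us); ring.
have P' := is_derive1_powR (k - 2) t_gt0.
have S' : is_derive t 1 (fun s : R => s ^+ 2) (2 * t).
  apply: is_derive_eq (is_deriveM (is_derive_id t 1) (is_derive_id t 1)) _.
  by rewrite /GRing.scale /= mulr1 mulr_natl mulr2n.
have W2' := is_deriveM S' (is_deriveB W' (is_derive_cst (f c) t 1)).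
have B2' := is_deriveZ (2 * k) (is_deriveM (is_derive_id t 1) B').
have Q' := is_deriveD (is_deriveD (is_deriveZ (k ^+ 2) A') B2') (is_deriveM S' V').
have E' := is_deriveD (is_deriveD W2' (is_deriveZ 2^-1 Q'))
  (is_deriveZ (k * (1 - r / 3) / 2) A').
apply: (is_derive_eq (is_deriveM P' (E' : is_derive t 1 E _))).
(* All the powers of [t] are expressed through [t `^ (k - 3)], after which the
   claim is a rational identity in the remaining scalars. *)
have -> : t `^ (k - 2) = t * t `^ (k - 3).
  rewrite -{2}[t]powRr1 ?ltW// -powRD; last by rewrite (gt_eqF t_gt0) implybT.
  by congr (_ `^ _); lra.
have -> : k - 2 - 1 = k - 3 by lra.
have ua : dot (u t) a = - (r / t * dot (u t) (v t) + dot g (u t)).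
  by rewrite dotNr dotDr dotZr (dotC g).
have va : dot (v t) a = - (r / t * dot (v t) (v t) + dot g (v t)).
  by rewrite dotNr dotDr dotZr (dotC g).
rewrite (dotC a) va ua (dotC (v t) (u t)) -/(u t) -/g -/k.
have -> : (f \o x - cst (f c)) t = f (x t) - f c by [].
rewrite /GRing.scale /= /E.
have -> : r = 3 / 2 * k by rewrite /k; lra.
move: (dot (u t) (u t)) (dot (u t) (v t)) (dot (v t) (v t)) => A B V.
move: (dot g (u t)) (dot g (v t)) (t `^ _) (f (x t)) (f c) => Gu Gv q fx fc.
by field; rewrite gt_eqF.
Qed.

Hypothesis r_gt0 : 0 < r.
Hypothesis mu_gt0 : 0 < mu.
Hypothesis f_sc : strongly_convex mu f.
Hypothesis c_min : forall q, f c <= f q.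

(** The derivative is at most [k t^(k-3) (r^2/9 - 1 - mu t^2 / 2) |u|^2] by
    strong convexity, and the assumption on [T] makes the bracket negative. *)
Lemma lyapunov_nonincreasing (T : R) :
  0 < T -> 2 * r ^+ 2 / 9 <= mu * T ^+ 2 ->
  forall s t, T <= s -> s <= t -> lyapunov r f c x t <= lyapunov r f c x s.
Proof.
move=> T_gt0 T_large.
have lyap' (t : R) : T <= t -> derivable (lyapunov r f c x) t 1.
  by move=> /(lt_le_trans T_gt0) /is_derive_lyapunov[].
apply: ler0_derive1_nincry => [t|t|].
- by rewrite in_itv /= andbT => /ltW /lyap'.
- rewrite in_itv /= andbT => Tt.
  have t_gt0 := lt_trans T_gt0 Tt.
  rewrite derive1E; have [_ ->] := is_derive_lyapunov t t_gt0.
  apply: mulr_ge0_le0; first by rewrite !mulr_ge0 ?powR_ge0 ?ltW.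
  have Wu := grad_pull _ _ f_sc (x t) c.
  have A_ge0 := dot_ge0 (x t - c).
  have t_large : 2 * r ^+ 2 / 9 <= mu * t ^+ 2.
    by apply: le_trans T_large _; rewrite ler_pM2l// ler_sqr ?nnegrE ltW.
  move: Wu A_ge0; set A := dot (x t - c) _; set W := f _ - _ - _ => Wu A_ge0.
  have W_le : t ^+ 2 * W <= - (mu * t ^+ 2 * A / 2).
    rewrite -[X in _ <= - X]mulrA -mulrA mulrCA -mulrN.
    by rewrite ler_wpM2l ?sqr_ge0// /W; lra.
  have := ler_wpM2r A_ge0 t_large; lra.
- apply: derivable_within_continuous => t.
  by rewrite in_itv /= andbT => /lyap'.
Qed.

(** The [|u|^2] term of [lyapunov] is negative when [3 < r].  Quadratic growth
    absorbs it: [t^2 W >= (r^2 / 9) |u|^2] on this range of times, and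
    [(1 + r/3) k (1 - r/3) / 2 = (r/3) (1 - r^2/9)], so the surplus [r/3] in
    the constant [1 + r/3] pays for it whatever the sign of [3 - r]. *)
Lemma lyapunov_lower_bound (t : R) :
  0 < t -> 2 * r ^+ 2 / 9 <= mu * t ^+ 2 ->
  t `^ (2 / 3 * r) * (f (x t) - f c) <= (1 + r / 3) * lyapunov r f c x t.
Proof.
move=> t_gt0 t_large.
have -> : t `^ (2 / 3 * r) = t `^ (2 / 3 * r - 2) * t ^+ 2.
  rewrite -powR_mulrn ?ltW// -powRD; last by rewrite (gt_eqF t_gt0) implybT.
  by congr (_ `^ _); lra.
rewrite /lyapunov -mulrA [leRHS]mulrCA ler_wpM2l ?powR_ge0//.
have := quadratic_growth _ _ f_sc c (x t) f_diff c_min.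
have := dot_ge0 (x t - c); set A := dot (x t - c) _.
have := dot_ge0 ((2 / 3 * r) *: (x t - c) + t *: derive1 x t).
set N := dot _ _; set W := f _ - _ => N_ge0 A_ge0 W_growth.
have tW : r ^+ 2 / 9 * A <= t ^+ 2 * W.
  apply: le_trans (ler_wpM2l (sqr_ge0 t) W_growth).
  have := ler_wpM2r A_ge0 t_large; lra.
rewrite -subr_ge0 [leRHS](_ : _ = (1 + r / 3) * (N / 2)
  + r / 3 * (A + (t ^+ 2 * W - r ^+ 2 / 9 * A))); last first.
  by field.
have r3_ge0 : 0 <= r / 3 by rewrite divr_ge0 ?ltW.
apply: addr_ge0; apply: mulr_ge0 => //.
- exact: addr_ge0.
- exact: divr_ge0.
- by rewrite addr_ge0 ?subr_ge0.
Qed.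

End Lyapunov.

Theorem theorem1 (R : realType) (n : nat) (r mu : R)
  (f : 'rV[R]_n -> R) (fstar : R) (x : R -> 'rV[R]_n)
  (r_gt0 : 0 < r) (mu_gt0 : 0 < mu)
  (f_diff : forall p : 'rV[R]_n, differentiable f p)
  (f_sc : strongly_convex mu f)
  (f_min : is_min_value f fstar)
  (x_diff : twice_derivable_pos x)
  (x_ode : forall t : R, 0 < t ->
     derive1 (derive1 x) t + (r / t) *: derive1 x t + grad f (x t) = 0) :
  bigO_from (Num.sqrt (2 * r ^+ 2 / (9 * mu)))
    (fun t : R => f (x t) - fstar)
    (fun t : R => t `^ (- (2 / 3 * r))).
Proof.
have [[c <-] c_min] := f_min.
set T := Num.sqrt _.
have T_gt0 : 0 < T by rewrite sqrtr_gt0 divr_gt0 ?mulr_gt0 ?exprn_gt0.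
have T_large : 2 * r ^+ 2 / 9 = mu * T ^+ 2.
  rewrite sqr_sqrtr; last by rewrite divr_ge0 ?mulr_ge0 ?sqr_ge0 ?ltW.
  by field; rewrite gt_eqF.
exists ((1 + r / 3) * lyapunov r f c x T) => t Tt.
have t_gt0 := lt_le_trans T_gt0 Tt.
rewrite ger0_norm ?subr_ge0// powRN ler_pdivlMr ?powR_gt0// mulrC.
have t_large : 2 * r ^+ 2 / 9 <= mu * t ^+ 2.
  by rewrite T_large ler_pM2l// ler_sqr ?nnegrE ?(ltW T_gt0) ?(ltW t_gt0).
have := lyapunov_lower_bound _ _ _ _ x f_diff r_gt0 f_sc c_min t t_gt0 t_large.
move=> /le_trans; apply.
rewrite ler_pM2l ?addr_gt0 ?divr_gt0//.
by apply: (lyapunov_nonincreasing _ mu _ _ _ _ _ _ _ _ _ T) => //; rewrite T_large.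
Qed.
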